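(* Let $K$ be a field, $n\ge 1$, and $S=K[x_1,\ldots,x_n]$. Let $a_1,\ldots,a_n$ be positive integers. Then, for ideals of $S$, \[ \operatorname{sdepth}((x_1^{a_1},\ldots,x_n^{a_n})) = \operatorname{sdepth}((x_1,\ldots,x_n)) = \left\lceil \frac{n}{2} \right\rceil. \] In particular, for any $1\leq m\leq n$, the ideal $(x_1^{a_1},\ldots,x_m^{a_m})$ of $S$ satisfies \[ \operatorname{sdepth}((x_1^{a_1},\ldots,x_m^{a_m})) = n - m + \left\lceil \frac{m}{2}\right\rceil. \]
   Context: Let $I$ be a nonzero monomial ideal of a polynomial ring $S=K[x_1,\ldots,x_n]$ over a field $K$. For a monomial $u\in S$ and a subset $Z\subset\{x_1,\ldots,x_n\}$, $uK[Z]$ denotes the $K$-subspace of $S$ spanned by all monomials $uw$ with $w$ a monomial in the variables of $Z$. A Stanley decomposition of $I$ is a finite direct sum decomposition of $K$-vector spaces $\mathcal D: I=\bigoplus_{i=1}^r u_iK[Z_i]$ with $u_i\in S$ monomials and $Z_i\subset\{x_1,\ldots,x_n\}$. Put $\operatorname{sdepth}(\mathcal D)=\min_{1\le i\le r}|Z_i|$. The Stanley depth of $I$ is $\operatorname{sdepth}(I)=\max\{\operatorname{sdepth}(\mathcal D) : \mathcal D \text{ is a Stanley decomposition of } I\}$. *)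

(* Defs.v *)
From HB Require Import structures.
From mathcomp Require Import all_boot all_order all_algebra.
From mathcomp Require Import boolp mpoly.
Set Implicit Arguments.
Unset Strict Implicit.
Unset Printing Implicit Defensive.
Import GRing.Theory.
Local Open Scope ring_scope.

Section Defs.
Variables (K : fieldType) (n : nat).
Local Notation S := {mpoly K[n]}.
Implicit Types (I : S -> Prop) (u : 'X_{1..n}) (Z : {set 'I_n}).

(* Subsets of [S] are Prop-valued: neither ideals nor K-subspaces of [S] fit
   {vspace _}, since [S] has infinite dimension over [K] as soon as n > 0. *)

Definition ideal_gen (m : nat) (g : 'I_m -> S) : S -> Prop :=
  fun p => exists c : 'I_m -> S, p = \sum_(i < m) c i * g i.

Definition kspan (A : S -> Prop) : S -> Prop :=
  fun p => exists (k : nat) (c : 'I_k -> K) (f : 'I_k -> S),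
    (forall j, A (f j)) /\ p = \sum_(j < k) c j *: f j.

(* u K[Z]; the variable x_i is encoded by its index i. *)
Definition stanley_space u Z : S -> Prop :=
  kspan (fun p => exists w : 'X_{1..n},
    (forall i, w i != 0%N -> i \in Z) /\ p = 'X_[u] * 'X_[w]).

Definition direct_sum (r : nat) (V : 'I_r -> S -> Prop) I : Prop :=
  (forall p, I p <->
     exists v : 'I_r -> S, (forall i, V i (v i)) /\ p = \sum_(i < r) v i) /\
  (forall v : 'I_r -> S, (forall i, V i (v i)) ->
     \sum_(i < r) v i = 0 -> forall i, v i = 0).

Definition stanley_decomposition I (r : nat)
    (u : 'I_r -> 'X_{1..n}) (Z : 'I_r -> {set 'I_n}) : Prop :=
  direct_sum (fun i => stanley_space (u i) (Z i)) I.

(* As #|Z i| <= n, the default value n only matters for r = 0, which cannot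
   occur in a decomposition of a nonzero ideal. *)
Definition sdepth_decomposition (r : nat) (Z : 'I_r -> {set 'I_n}) : nat :=
  \big[minn/n]_(i < r) #|Z i|.

Definition attains_sdepth I (k : nat) : Prop :=
  exists (r : nat) (u : 'I_r -> 'X_{1..n}) (Z : 'I_r -> {set 'I_n}),
    stanley_decomposition I u Z /\ sdepth_decomposition Z = k.

(* Depths of decompositions never exceed n, so bounding k loses nothing;
   [sdepthP] states that this is the maximum. *)
Definition sdepth I : nat := (\max_(k < n.+1 | `[< attains_sdepth I k >]) k)%N.

Lemma sdepth_decomposition_le (r : nat) (Z : 'I_r -> {set 'I_n}) :
  (sdepth_decomposition Z <= n)%N.
Proof.
rewrite /sdepth_decomposition; elim/big_rec: _ => // i x _ le_xn.
exact: leq_trans (geq_minr _ _) le_xn.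
Qed.

Lemma sdepthP I : (exists k, attains_sdepth I k) ->
  attains_sdepth I (sdepth I) /\
  (forall k, attains_sdepth I k -> (k <= sdepth I)%N).
Proof.
have attains_lt k : attains_sdepth I k -> (k < n.+1)%N.
  by case=> r [u [Z [_ <-]]]; rewrite ltnS sdepth_decomposition_le.
case=> k0 Ik0; split=> [|k Ik]; last first.
  by apply: (leq_bigmax_cond (Ordinal (attains_lt k Ik))); apply/asboolP.
have P0 : `[< attains_sdepth I (Ordinal (attains_lt k0 Ik0)) >] by apply/asboolP.
rewrite /sdepth (bigmax_eq_arg _ P0).
by case: arg_maxnP => // i /asboolP.
Qed.

End Defs.

(* Main.v *)
(* Upper bound: let c = x_1^(a_1 - 1) ... x_m^(a_m - 1). The pieces containing
   c x_1, ..., c x_m compete for the m (m + 1) / 2 monomials c x_i x_j, so one of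
   them has at most (m + 1) / 2 free variables among x_1, ..., x_m.

   Lower bound: the nonempty subsets of a set of m elements can be partitioned
   into intervals [A, B] with |B| >= m / 2. For m odd, place the elements on a
   circle; a nonzero cyclic 0/1-word is uniquely a concatenation of tiles "1" and
   "*0", where * is arbitrary, and the words with a given tiling form an interval
   [A, B] with |B| = (m + |A|) / 2; A is nonempty because m is odd. For m even,
   add an element and keep only the subsets without it. Sorting the monomials w
   of the ideal by the interval that contains {i | a_i <= w_i} yields a Stanley
   decomposition. *)
Require Import Defs.
From mathcomp Require Import all_boot all_order all_algebra.
From mathcomp Require Import mpoly zify.
Set Implicit Arguments.
Unset Strict Implicit.
Unset Printing Implicit Defensive.
Import GRing.Theory.
Local Open Scope ring_scope.

Definition mem_interval (T : finType) (X : {set T}) (P : {set T} * {set T}) :=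
  (P.1 \subset X) && (X \subset P.2).

(** Nonempty lower ends keep the empty set out of every interval; the uniqueness clause makes the
    intervals disjoint. *)
Definition interval_partition (T : finType) (D : {set T}) (q : nat)
    (F : {set {set T} * {set T}}) : Prop :=
  (forall P, P \in F ->
     [/\ P.1 != set0, P.1 \subset P.2, P.2 \subset D & (q <= #|P.2|)%N]) /\
  (forall X, X != set0 -> X \subset D ->
     exists P, [/\ P \in F, mem_interval X P
       & forall Q, Q \in F -> mem_interval X Q -> Q = P]).

(** * Tilings of cyclic words *)

Section CyclicTiling.
Local Open Scope nat_scope.
Variables (T : finType) (s : T -> T).
Hypotheses (s_inj : injective s) (s_trans : forall x y, fconnect s x y).
Implicit Types (x : T) (X E : {set T}).

(* X is the 0/1-word, s the cyclic successor, and E the set of second positions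
   of the tiles "*0". *)
Definition tiling X E := forall x, (x \in E) = (x \notin X) && (s x \notin E).

Lemma iter_mem X : X != set0 -> forall x, exists k, iter k s x \in X.
Proof.
case/set0Pn=> y yX x; exists (findex s x y).
by rewrite iter_findex // s_trans.
Qed.

(** Take for [E] the positions at odd forward distance from the next element of [X]; the defining
    equation says that parity alternates along each gap. *)
Lemma tiling_exists X : X != set0 -> exists E, tiling X E.
Proof.
move=> X0; pose d x := ex_minn (iter_mem X0 x).
have d0 x : x \in X -> d x = 0.
  by move=> xX; rewrite /d; case: ex_minnP => k _ /(_ 0 xX); case: k.
have dS x : x \notin X -> d x = (d (s x)).+1.
  move=> xX; rewrite /d; case: ex_minnP => k kX kmin.
  case: ex_minnP => l lX lmin; apply/eqP; rewrite eqn_leq kmin ?iterSr //=.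
  case: k kX {kmin} => [|k]; first by rewrite /= (negPf xX).
  by rewrite iterSr => /lmin.
exists [set x | odd (d x)] => x; rewrite !inE.
by case: (boolP (x \in X)) => [/d0 ->|/dS ->].
Qed.

(** On [X] both sets are empty, and the defining equation carries agreement from [s x] back to [x];
    every position reaches [X]. *)
Lemma tiling_uniq X E1 E2 : X != set0 -> tiling X E1 -> tiling X E2 -> E1 = E2.
Proof.
move=> X0 t1 t2; apply/setP=> x; have [k] := iter_mem X0 x.
elim: k x => [|k IH] x; first by rewrite t1 t2 /= => ->.
by rewrite iterSr => /IH eqE; rewrite t1 t2 eqE.
Qed.

(** Outside [E] and its preimage lie the tiles 1, whose letter is forced; the preimage of [E] holds
    the free first letters of the two-letter tiles. *)
Definition tiling_interval E := (~: (E :|: s @^-1: E), ~: E).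

Definition tilings := [set E : {set T} | [disjoint E & s @^-1: E]].

Lemma tilingP X E :
  tiling X E <-> E \in tilings /\ mem_interval X (tiling_interval E).
Proof.
split=> [tE | []].
  split.
    rewrite inE; apply/pred0P=> x; rewrite /= !inE tE.
    by case: (s x \in E); rewrite ?andbF.
  by apply/andP; split; apply/subsetP=> x; rewrite !inE tE;
    case: (x \in X); case: (s x \in E).
rewrite inE => /pred0P dE /andP[/subsetP lo /subsetP up] x.
have := dE x; have := lo x; have := up x; rewrite /= !inE.
by case: (x \in E); case: (x \in X); case: (s x \in E) => //= A B; rewrite ?A ?B.
Qed.

Lemma card_tilings E : E \in tilings -> #|E :|: s @^-1: E| = #|E|.*2.
Proof.
rewrite inE -setI_eq0 => /eqP dE.
by have := cardsUI E (s @^-1: E); rewrite dE cards0 addn0 card_preimset // addnn.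
Qed.

Lemma cyclic_interval_partition : odd #|T| ->
  interval_partition [set: T] (uphalf #|T|) (tiling_interval @: tilings).
Proof.
move=> oT; split=> [_ /imsetP[E tE ->] | X X0 _]; last first.
  have [E tE] := tiling_exists X0; have [E' XE'] := (tilingP X E).1 tE.
  exists (tiling_interval E); split=> //; first exact: imset_f.
  move=> _ /imsetP[E2 tE2 ->] XE2; congr tiling_interval.
  by apply: (tiling_uniq X0) tE; apply/tilingP.
(* The lower end has |T| - 2|E| elements, an odd number and so not zero; the upper end has |T| -
   |E|. *)
have cE := card_tilings tE.
have cC : #|E| + #|~: E| = #|T| := cardsC E.
have cU : _ + #|~: (E :|: s @^-1: E)| = #|T| := cardsC (E :|: s @^-1: E).
split=> /=; rewrite ?subsetT //; first 1 last.
- by rewrite setCS subsetUl.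
- rewrite uphalf_half oT; have := odd_double_half #|T|; rewrite oT; lia.
by rewrite -card_gt0; lia.
Qed.

End CyclicTiling.

(** * Interval partitions for arbitrary finite sets *)

Section IntervalPartition.
Local Open Scope nat_scope.

Lemma iter_ordS n k (i : 'I_n) : iter k (@ordS n) i = (i + k) %% n :> nat.
Proof.
elim: k => [|k IH] /=; first by rewrite addn0 modn_small.
by rewrite IH -addn1 modnDml addn1 addnS.
Qed.

Lemma fconnect_ordS n (i j : 'I_n) : fconnect (@ordS n) i j.
Proof.
suff <- : iter (n - i + j) (@ordS n) i = j by exact: fconnect_iter.
apply: val_inj; rewrite /= iter_ordS addnA subnKC; last exact: ltnW.
by rewrite modnDl modn_small.
Qed.

Lemma interval_partition_exists (T : finType) (D : {set T}) :
  exists F, interval_partition D (uphalf #|D|) F.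
Proof.
have [->|/set0Pn[x0 x0D]] := eqVneq D set0.
  exists set0; split=> [P|X X0]; first by rewrite inE.
  by rewrite subset0 (negPf X0).
(* [N] is the least odd number that is at least |D|, so at most one point is added. *)
pose k := #|D|./2; pose N := k.*2.+1.
have oN : odd #|'I_N| by rewrite card_ord /N /= odd_double.
have [F0] : exists F, interval_partition [set: 'I_N] (uphalf #|'I_N|) F.
  eexists; apply: (cyclic_interval_partition (@ordS_inj N)) => //.
  exact: fconnect_ordS.
rewrite card_ord {oN} => -[F0q F0X].
have DN : #|D| <= N.
  by rewrite /N /k -[X in X <= _]odd_double_half; case: (odd _).
pose f x : 'I_N := inord (index x (enum D)).
have f_inj : {in D &, injective f}.
  move=> x y xD yD /(congr1 val); rewrite /f /= !inordK; first last.
  - by apply: leq_trans DN; rewrite cardE index_mem mem_enum.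
  - by apply: leq_trans DN; rewrite cardE index_mem mem_enum.
  by apply: index_inj; rewrite ?mem_enum.
pose tr (A : {set 'I_N}) := [set x in D | f x \in A].
have trK (A : {set 'I_N}) : f @: tr A = A :&: f @: D.
  apply/setP=> y; rewrite inE; apply/imsetP/andP=> [[x]|[yA /imsetP[x xD yx]]].
    by rewrite inE => /andP[xD xA] ->; rewrite imset_f.
  by exists x; rewrite // inE xD -yx.
have tr_sub (A : {set 'I_N}) (X : {set T}) :
    X \subset D -> (X \subset tr A) = (f @: X \subset A).
  move=> XD; apply/subsetP/subsetP=> h.
    by move=> _ /imsetP[x /h + ->]; rewrite inE => /andP[].
  by move=> x xX; rewrite inE (subsetP XD) // h // imset_f.
have sub_tr (A : {set 'I_N}) (X : {set T}) :
    A \subset f @: D -> X \subset D -> (tr A \subset X) = (A \subset f @: X).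
  move=> AD XD; apply/subsetP/subsetP=> h x xA.
    have /imsetP[y yD xy] := subsetP AD _ xA.
    by rewrite xy imset_f // h // inE yD -xy.
  move: xA; rewrite inE => /andP[xD /h /imsetP[y yX]].
  by move/f_inj => -> //; rewrite (subsetP XD).
(* An interval whose lower end is not inside [f @: D] contains no image of a subset of [D] and is
   dropped. *)
exists [set (tr P.1, tr P.2) | P in F0 & P.1 \subset f @: D]; split.
  move=> _ /imsetP[P + ->] /=; rewrite inE => /andP[/F0q[P0 P12 _ cP] PD].
  have trD A : tr A \subset D by apply/subsetP=> x; rewrite inE => /andP[].
  split=> //.
  - case/set0Pn: P0 => y yP; have /imsetP[x xD yx] := subsetP PD _ yP.
    by apply/set0Pn; exists x; rewrite inE xD -yx.
  - by apply/subsetP=> x; rewrite !inE => /andP[-> /(subsetP P12)].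
  have <- : #|f @: tr P.2| = #|tr P.2|.
    apply: card_in_imset => x y; rewrite !inE => /andP[xD _] /andP[yD _].
    exact: f_inj.
  (* Restriction removes at most N - |D| points: none for |D| odd, one for |D| even, where the bound
     for [N] exceeds the bound for |D| by one. *)
  rewrite trK; have := cardsUI P.2 (f @: D); rewrite (card_in_imset f_inj).
  have := max_card (P.2 :|: f @: D); rewrite card_ord.
  have := odd_double_half #|D|; rewrite uphalf_half -/k.
  move: cP; rewrite /N /= doubleK; clearbody k.
  by case: (odd _) => /=; move: #|_| #|_| #|_| #|_|; lia.
move=> X X0 XD; have fX0 : f @: X != set0.
  by case/set0Pn: X0 => x xX; apply/set0Pn; exists (f x); exact: imset_f.
have [P [PF /andP[P1 P2] Puniq]] := F0X _ fX0 (subsetT _).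
have PD : P.1 \subset f @: D := subset_trans P1 (imsetS f XD).
exists (tr P.1, tr P.2); split.
- by apply: imset_f; rewrite inE PF.
- by rewrite /mem_interval /= sub_tr // tr_sub // P1.
move=> _ /imsetP[Q + ->]; rewrite inE => /andP[QF QD].
by rewrite /mem_interval /= sub_tr // tr_sub // => /(Puniq Q QF) ->.
Qed.

End IntervalPartition.

(** * Stanley decompositions as partitions of the set of monomials *)

Section Monomials.
Variables (K : fieldType) (n : nat).
Local Notation S := {mpoly K[n]}.
Local Notation mon := 'X_{1..n}.
Implicit Types (p : S) (u w : mon) (Z D : {set 'I_n}) (Q : pred mon).

Definition in_piece u Z : pred mon :=
  fun w => (u <= w)%MM && [forall j, (j \notin Z) ==> (w j == u j)].

Definition in_power_ideal D (a : 'I_n -> nat) : pred mon :=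
  fun w => [exists j in D, (a j <= w j)%N].

Lemma in_pieceP u Z w :
  reflect ((forall j, u j <= w j)%N /\ (forall j, j \notin Z -> w j = u j))
          (in_piece u Z w).
Proof.
apply: (iffP andP) => [[/mnm_lepP uw /'forall_implyP h]|[uw h]].
  by split=> // j /h /eqP.
by split; [exact/mnm_lepP | apply/'forall_implyP => j /h ->].
Qed.

(** These polynomials form the span of the monomials in [Q]; Stanley spaces and monomial ideals are
    both of this kind. *)
Definition supported_in Q p := forall w, w \in msupp p -> Q w.

Lemma supported_in_sum Q (I : Type) (s : seq I) (P : pred I) (F : I -> S) :
  (forall i, P i -> supported_in Q (F i)) ->
  supported_in Q (\sum_(i <- s | P i) F i).
Proof.
move=> FQ; apply: (big_ind (supported_in Q)) => // [w|p q pQ qQ w].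
  by rewrite msupp0.
by move/msuppD_le; rewrite mem_cat => /orP[/pQ|/qQ].
Qed.

Lemma supported_inZ Q (c : K) p : supported_in Q p -> supported_in Q (c *: p).
Proof. by move=> pQ w /msuppZ_le /pQ. Qed.

Lemma supported_inX Q w : supported_in Q 'X_[w] <-> Q w.
Proof.
split=> [|Qw w']; first by apply; rewrite msuppX inE.
by rewrite msuppX inE => /eqP ->.
Qed.

Lemma stanley_spaceP u Z p :
  stanley_space u Z p <-> supported_in (in_piece u Z) p.
Proof.
split=> [[k [c [f [fA ->]]]]|pQ].
  apply: supported_in_sum => j _; apply: supported_inZ.
  have [w [wZ ->]] := fA j; rewrite -mpolyXD; apply/supported_inX.
  apply/in_pieceP; split=> i; rewrite mnmDE ?leq_addr // => iZ.
  suff -> : w i = 0%N by rewrite addn0.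
  by apply/eqP; apply: contraNT iZ => /wZ.
exists (size (msupp p)), (fun j => p@_(nth 0%MM (msupp p) j)),
  (fun j => 'X_[nth 0%MM (msupp p) j]); split=> [j|].
  have /pQ /in_pieceP[uw wZ] := mem_nth 0%MM (ltn_ord j).
  set w := nth _ _ _ in uw wZ *; exists (w - u)%MM; split=> [i|].
    by rewrite mnmBE; apply: contraNT => /wZ ->; rewrite subnn.
  by rewrite -mpolyXD addmC submK //; apply/mnm_lepP.
by rewrite [LHS]mpolyE (big_nth 0%MM) big_mkord.
Qed.

Lemma ideal_genP (m : nat) (g : 'I_m -> 'I_n) (a : 'I_n -> nat) p :
  ideal_gen (fun i : 'I_m => ('X_(g i) : S) ^+ a (g i)) p
  <-> supported_in (in_power_ideal (g @: 'I_m) a) p.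
Proof.
split=> [[c ->]|pQ].
  apply: supported_in_sum => i _ w; rewrite mpolyXn => wi.
  have : w \in [seq (U_(g i) *+ a (g i) + w')%MM | w' <- msupp (c i)].
    by rewrite -(perm_mem (msuppMX _ _)).
  case/mapP=> w' _ ->; apply/exists_inP; exists (g i); first exact: imset_f.
  by rewrite mnmDE mulmnE mnm1E eqxx mul1n leq_addr.
rewrite [p]mpolyE big_seq; apply: big_ind => [|_ _ [c1 ->] [c2 ->]|w].
- by exists (fun=> 0); rewrite big1 // => i _; rewrite mul0r.
- exists (fun i => c1 i + c2 i); rewrite -big_split /=.
  by apply: eq_bigr => i _; rewrite mulrDl.
move/pQ => /exists_inP[_ /imsetP[i0 _ ->] aw].
exists (fun i => if i == i0
  then p@_w *: 'X_[w - U_(g i0) *+ a (g i0)] else 0).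
rewrite (bigD1 i0) //= eqxx big1 => [|i /negPf ->]; last by rewrite mul0r.
rewrite addr0 mpolyXn -scalerAl -mpolyXD submK //.
apply/mnm_lepP=> j; rewrite mulmnE mnm1E.
by case: eqP => [<-|]; rewrite ?mul1n.
Qed.

Definition monomial_partition (r : nat) (Q : 'I_r -> pred mon) Q0 :=
  [/\ forall w, Q0 w -> exists i, Q i w, forall i w, Q i w -> Q0 w
    & forall i j w, Q i w -> Q j w -> i = j].

(** Monomials form a basis of [S], so sums and linear relations of monomial subspaces can be tested
    one monomial at a time. *)
Lemma direct_sumP (r : nat) (V : 'I_r -> S -> Prop) (I : S -> Prop)
    (Q : 'I_r -> pred mon) Q0 :
  (forall i p, V i p <-> supported_in (Q i) p) ->
  (forall p, I p <-> supported_in Q0 p) ->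
  direct_sum V I <-> monomial_partition Q Q0.
Proof.
move=> VQ IQ; split=> [[sumVI indep]|[Q0Q QQ0 Quniq]].
  have XV i w : Q i w -> V i 'X_[w] by move=> ?; apply/VQ/supported_inX.
  have V0 i : V i 0 by apply/VQ=> w; rewrite msupp0.
  split=> [w Q0w|i w Qw|i j w Qi Qj].
  - have /IQ/sumVI[v [vV wv]] : supported_in Q0 'X_[w] by apply/supported_inX.
    have : w \in msupp ('X_[w] : S) by rewrite msuppX inE.
    have := @supported_in_sum [pred w | [exists i, Q i w]] _ (index_enum 'I_r)
      xpredT v.
    rewrite -wv => /(_ _ w) h /h /existsP h'; apply: h' => i _ w'.
    by move/(VQ i _).1: (vV i) => /[apply] Qi; apply/existsP; exists i.
  - apply/(@supported_inX _ w)/IQ/sumVI.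
    exists (fun k => if k == i then 'X_[w] else 0); split=> [k|].
      by case: eqP => [->|_]; [exact: XV | exact: V0].
    by rewrite -big_mkcond big_pred1_eq.
  apply/eqP/negPn/negP => ij.
  (* A monomial in two pieces would give the nontrivial relation w - w = 0. *)
  pose v k : S := if k == i then 'X_[w] else if k == j then - 'X_[w] else 0.
  have vV k : V k (v k).
    rewrite /v; case: eqP => [->|_]; first exact: XV.
    case: eqP => [->|_]; last exact: V0.
    by apply/VQ; rewrite -scaleN1r; apply/supported_inZ/VQ/XV.
  have v0 : \sum_k v k = 0.
    rewrite (bigD1 i) //= (bigD1 j) 1?eq_sym //= big1 => [|k].
      by rewrite /v eqxx eq_sym (negPf ij) eqxx addr0 subrr.
    by rewrite /v => /andP[/negPf -> /negPf ->].
  have := indep v vV v0 i; rewrite /v eqxx => /(congr1 (mcoeff w)).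
  by rewrite mcoeffX mcoeff0 eqxx => /eqP; rewrite oner_eq0.
split=> [p|v vV v0 i].
  split=> [/IQ pQ|[v [vV ->]]]; last first.
    apply/IQ/supported_in_sum => i _ w wv.
    by apply: QQ0; apply: (VQ i _).1 wv; exact: vV.
  exists (fun i => \sum_(w <- msupp p | Q i w) p@_w *: 'X_[w]); split=> [i|].
    by apply/VQ/supported_in_sum => w Qw; apply/supported_inZ/supported_inX.
  rewrite [LHS]mpolyE [RHS](exchange_big_dep xpredT) //= big_seq [RHS]big_seq.
  apply: eq_bigr => w /pQ/Q0Q[i Qi].
  rewrite (big_pred1 i) // => j /=.
  by apply/idP/eqP => [Qj|-> //]; exact: Quniq Qj Qi.
apply/eqP; rewrite -msupp_eq0; case E: (msupp _) => [//|w s].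
(* A monomial of [v i] occurs in no other summand, so its nonzero coefficient survives in the
   sum. *)
have wi : w \in msupp (v i) by rewrite E mem_head.
have Qi := (VQ i _).1 (vV i) _ wi.
move/(congr1 (mcoeff w))/eqP: v0; rewrite raddf_sum mcoeff0 (bigD1 i) //= big1.
  by rewrite addr0 mcoeff_eq0 wi.
move=> j ji; apply/eqP; rewrite mcoeff_eq0; apply/negP => /(VQ j _).1.
by case/(_ (vV j))/Quniq/(_ Qi)/eqP/idPn.
Qed.

Lemma sdepth_eq (I : S -> Prop) (d : nat) : (d <= n)%N ->
  (exists (r : nat) (u : 'I_r -> mon) (Z : 'I_r -> {set 'I_n}),
     stanley_decomposition I u Z /\ forall i, (d <= #|Z i|)%N) ->
  (forall (r : nat) (u : 'I_r -> mon) (Z : 'I_r -> {set 'I_n}),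
     stanley_decomposition I u Z -> exists i, (#|Z i| <= d)%N) ->
  sdepth I = d.
Proof.
move=> dn [r [u [Z [dec dZ]]]] up.
have attains : attains_sdepth I (sdepth_decomposition Z) by exists r, u, Z.
have [|[r' [u' [Z' [dec' <-]]]] maxI] := @sdepthP _ _ I.
  by exists (sdepth_decomposition Z).
apply/eqP; rewrite eqn_leq; apply/andP; split.
  have [i Zi] := up _ _ _ dec'; apply: leq_trans Zi.
  exact: (@Order.TotalTheory.bigmin_le _ nat _ n i (fun i => #|Z' i|)).
apply: leq_trans (maxI _ attains).
(* The minimum starts from the default [n], which is where [d <= n] enters. *)
exact: (introT (@Order.TotalTheory.bigmin_geP _ nat _ n d xpredT _)).
Qed.
End Monomials.

(** * Both bounds for ideals generated by powers of variables *)

Section PowerIdeal.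
Local Open Scope nat_scope.
Variables (n : nat) (a : 'I_n -> nat) (D : {set 'I_n}).
Hypothesis a_gt0 : forall i, 0 < a i.
Local Notation mon := 'X_{1..n}.
Implicit Types (u w : mon) (Z A B : {set 'I_n}).

Definition large_exponents w := [set i in D | a i <= w i].

Lemma large_exponents_sub w : large_exponents w \subset D.
Proof. by apply/subsetP=> i; rewrite inE => /andP[]. Qed.

Lemma in_power_ideal_large w :
  in_power_ideal D a w = (large_exponents w != set0).
Proof.
apply/exists_inP/set0Pn => [[i iD iw]|[i]]; first by exists i; rewrite inE iD.
by rewrite inE => /andP[]; exists i.
Qed.

(* The monomials whose set of large exponents lies in [A, B] form a disjoint
   union of Stanley spaces, indexed by the exponents w_i < a_i with i in
   D \ B. *)
Definition piece_exponent A B (w : 'I_n -> nat) i :=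
  if i \in A then a i else if i \in B :|: ~: D then 0 else w i.

(** On A, divisibility by [u] means w_i >= a_i; on B \ A and outside D, u_i = 0 imposes nothing; on
    D \ B, w_i = u_i < a_i keeps i out of the large exponents. *)
Lemma in_pieceE A B u w :
  A \subset B -> B \subset D -> piece_exponent A B u =1 u ->
  (forall i, i \in D -> i \notin B -> u i < a i) ->
  in_piece u (B :|: ~: D) w =
  mem_interval (large_exponents w) (A, B) &&
  [forall i, piece_exponent A B w i == u i].
Proof.
move=> AB BD uE ua; apply/in_pieceP/andP => [[uw wu]|[/andP[Aw wB] /forallP wu]].
  split; first (apply/andP; split; apply/subsetP=> i).
  - move=> iA; rewrite inE (subsetP BD) ?(subsetP AB) //=.
    by apply: leq_trans (uw i); rewrite -uE /piece_exponent iA.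
  - rewrite inE => /andP[iD aw]; apply: contraLR aw => iB.
    by rewrite -ltnNge wu ?ua // !inE negb_or iB negbK.
  apply/forallP=> i; rewrite -uE /piece_exponent.
  by case: ifP => // _; case: ifP => // /negbT /wu ->.
split=> i; rewrite -(eqP (wu i)) /piece_exponent.
  case: ifP => [/(subsetP Aw)|_]; first by rewrite inE => /andP[].
  by case: ifP.
case: ifP => [/(subsetP AB) iB|_ /negPf -> //].
by rewrite inE iB.
Qed.

Lemma power_ideal_partition : exists r (u : 'I_r -> mon) (Z : 'I_r -> {set 'I_n}),
  monomial_partition (fun i => in_piece (u i) (Z i)) (in_power_ideal D a) /\
  forall i, n - #|D| + uphalf #|D| <= #|Z i|.
Proof.
have [F [Fq FX]] := interval_partition_exists D.
(* Generators need no exponent above [M], so a finite index type suffices. *)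
pose M := \max_i a i; have aM i : a i <= M by exact: leq_bigmax.
pose idx : finType := (({set 'I_n} * {set 'I_n}) * {ffun 'I_n -> 'I_M.+1})%type.
pose ok (t : idx) := (t.1 \in F) && [forall i,
  (piece_exponent t.1.1 t.1.2 (fun j => t.2 j) i == t.2 i) &&
  ((i \in D) && (i \notin t.1.2) ==> (t.2 i < a i))].
pose OK := [set t | ok t].
pose u (t : idx) : mon := [multinom nat_of_ord (t.2 i) | i < n].
pose Z (t : idx) := t.1.2 :|: ~: D.
have mem_piece t w : t \in OK -> in_piece (u t) (Z t) w =
  mem_interval (large_exponents w) t.1 &&
  [forall i, piece_exponent t.1.1 t.1.2 w i == t.2 i].
  rewrite inE => /andP[/Fq[_ AB BD _] /forallP h].
  rewrite /Z (@in_pieceE t.1.1) // -?surjective_pairing.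
  - by congr (_ && _); apply: eq_forallb => i; rewrite mnmE.
  - move=> i; rewrite mnmE /piece_exponent mnmE.
    by have /andP[/eqP + _] := h i.
  - by move=> i iD iB; rewrite mnmE; have /andP[_] := h i; rewrite iD iB.
exists #|OK|, (fun i => u (enum_val i)), (fun i => Z (enum_val i)).
split; last first.
  move=> i; have := enum_valP i; rewrite inE => /andP[/Fq[_ _ BD cB] _].
  rewrite /Z cardsU; have -> : (enum_val i).1.2 :&: ~: D = set0.
    by apply/eqP; rewrite -setDE setD_eq0.
  by rewrite cards0 subn0 addnC (cardsCs (~: D)) setCK card_ord leq_add2r.
split=> [w|i w|i j w].
- rewrite in_power_ideal_large => T0.
  have [|P [PF Tw _]] := FX _ T0; first exact: large_exponents_sub.
  have [_ AB BD _] := Fq _ PF; have [/subsetP AT /subsetP TB] := andP Tw.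
  (* The generator of the piece containing [w]; its entries are at most [M], so [inord] never falls
     back on its default. *)
  pose v : {ffun 'I_n -> 'I_M.+1} := [ffun i => inord (piece_exponent P.1 P.2 w i)].
  have small i : i \in D -> i \notin P.2 -> w i < a i.
    move=> iD; apply: contraNltn => aw; apply: TB.
    by rewrite inE iD.
  have vE i : v i = piece_exponent P.1 P.2 w i :> nat.
    rewrite ffunE inordK // ltnS /piece_exponent; case: ifP => // iA.
    case: ifP => // /negbT; rewrite !inE negb_or negbK => /andP[iB iD].
    by apply: leq_trans (aM i); rewrite ltnW ?small.
  have tOK : (P, v) \in OK.
    rewrite inE /ok PF /=; apply/forallP=> i; apply/andP; split.
      rewrite {1}/piece_exponent !vE /piece_exponent.
      by case: (i \in P.1) => //; case: (i \in _).
    apply/implyP=> /andP[iD iB]; rewrite vE /piece_exponent.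
    rewrite (contraNF (subsetP AB i) iB) !inE (negPf iB) iD /=.
    exact: small.
  exists (enum_rank_in tOK (P, v)); rewrite enum_rankK_in // mem_piece // Tw.
  by apply/forallP=> i; rewrite vE.
- rewrite mem_piece ?enum_valP // => /andP[/andP[AT _] _].
  have := enum_valP i; rewrite inE => /andP[/Fq[A0 _ _ _] _].
  rewrite in_power_ideal_large; apply: contraNneq A0 => T0.
  by rewrite -subset0 -T0.
rewrite !mem_piece ?enum_valP // => /andP[wi vi] /andP[wj vj].
apply: enum_val_inj; case: (enum_val i) (enum_valP i) wi vi => P v.
case: (enum_val j) (enum_valP j) wj vj => P' v' /=.
rewrite !inE => /andP[PF' _] wP' vE' /andP[PF _] wP vE.
have T0 : large_exponents w != set0.
  have [A0 _ _ _] := Fq _ PF; apply: contraNneq A0 => T0.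
  by rewrite -subset0 -T0; case/andP: wP.
(* Both intervals contain the large exponents of [w], hence coincide; both vectors are then
   determined by [w]. *)
have [|P0 [_ _ uniqP]] := FX _ T0; first exact: large_exponents_sub.
have /= eP := uniqP _ PF wP; have /= eP' := uniqP _ PF' wP'.
rewrite eP eP' in vE vE' *; congr (_, _); apply/ffunP => k; apply: val_inj.
by rewrite /= -(eqP (forallP vE k)) (eqP (forallP vE' k)).
Qed.

(** Two distinct elements are related in at most one direction, so for fixed x the relations from
    and to x number at most (|C| - 1) + 2, the loop counting twice. *)
Lemma antisymmetric_count (T : finType) (C : {set T}) (R : rel T) :
  {in C &, forall x y, R x y -> R y x -> x = y} ->
  (\sum_(x in C) #|[set y in C | R x y]|).*2 <= #|C| * #|C|.+1.
Proof.
move=> antiR.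
have -> : \sum_(x in C) #|[set y in C | R x y]| = \sum_(x in C) \sum_(y in C) R x y.
  apply: eq_bigr => x _; rewrite -sum1_card (eq_bigl _ _ (in_set _)) big_mkcondr.
  by apply: eq_bigr => y _; case: (R x y).
rewrite -addnn {2}exchange_big -big_split /=.
apply: (@leq_trans (\sum_(x in C) #|C|.+1)); last by rewrite sum_nat_const.
apply: leq_sum => x xC; rewrite -big_split /= (bigD1 x) //=.
rewrite (cardsD1 x C) xC addnC [X in _ <= X.+1]addnC -addnS leq_add //; last first.
  by case: (R x x).
rewrite -sum1_card [leqRHS](eq_bigl (fun y => (y \in C) && (y != x))).
  apply: leq_sum => y /andP[yC yx].
  have := antiR x y xC yC; case: (R x y); case: (R y x) => // /(_ isT isT) xy.
  by rewrite xy eqxx in yx.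
by move=> y; rewrite !inE andbC.
Qed.

(* The monomial c of the proof is not in the ideal, but each c x_i is; if x_j is
   a free variable of the piece of c x_i and x_i of that of c x_j, then c x_i x_j
   lies in both, so the pieces coincide and their generator divides
   gcd(c x_i, c x_j) = c. *)
Lemma power_ideal_bound r (u : 'I_r -> mon) (Z : 'I_r -> {set 'I_n}) :
  D != set0 ->
  monomial_partition (fun i => in_piece (u i) (Z i)) (in_power_ideal D a) ->
  exists i, #|Z i| <= n - #|D| + uphalf #|D|.
Proof.
case/set0Pn=> i0 i0D [cover inI disj].
pose c : mon := [multinom if i \in D then (a i).-1 else 0 | i < n].
have cI i : i \in D -> in_power_ideal D a (c + U_(i))%MM.
  move=> iD; apply/exists_inP; exists i => //.
  by rewrite mnmDE mnm1E eqxx mnmE iD addn1 prednK.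
have c_notin : ~~ in_power_ideal D a c.
  apply/exists_inP => -[i iD]; rewrite mnmE iD.
  by have := a_gt0 i; case: (a i) => // k _; rewrite ltnn.
(* The choice function is total: outside [D] it takes an arbitrary piece, supplied by [i0]. *)
have /fin_all_exists[s sP] : forall i, exists k,
    i \in D -> in_piece (u k) (Z k) (c + U_(i))%MM.
  move=> i; have [iD|_] := boolP (i \in D); last first.
    by have [k _] := cover _ (cI _ i0D); exists k.
  by have [k] := cover _ (cI _ iD); exists k.
pose R : rel 'I_n := fun i j => j \in Z (s i).
have step i j : i \in D -> R i j ->
    in_piece (u (s i)) (Z (s i)) (c + U_(i) + U_(j))%MM.
  move=> iD Rij; have /in_pieceP[le eq] := sP _ iD.
  apply/in_pieceP; split=> k; rewrite mnmDE.
    by apply: leq_trans (le k) _; rewrite leq_addr.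
  move=> kZ; rewrite eq // mnm1E; case: eqP => [jk|]; last by rewrite addn0.
  by rewrite /R jk (negPf kZ) in Rij.
have antiR : {in D &, forall i j, R i j -> R j i -> i = j}.
  move=> i j iD jD Rij Rji; apply/eqP/negPn/negP => ij.
  have eq_s : s i = s j.
    apply: (disj _ _ (c + U_(i) + U_(j))%MM); first exact: step.
    by rewrite -addmA [(U_(i) + _)%MM]addmC addmA; exact: step.
  have /in_pieceP[lei _] := sP _ iD; have /in_pieceP[lej _] := sP _ jD.
  have /exists_inP[k kD ak] : in_power_ideal D a (u (s i)).
    by apply: inI (s i) _ _; apply/in_pieceP.
  case/exists_inP: c_notin; exists k => //; apply: leq_trans ak _.
  have := lei k; have := lej k; rewrite -eq_s !mnmDE !mnm1E.
  case: (i =P k) => [<-|_]; last by rewrite addn0.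
  by rewrite eq_sym (negPf ij) addn0.
case: (boolP [exists i, #|Z i| <= n - #|D| + uphalf #|D|]) => [/existsP //|].
rewrite negb_exists => /forallP big.
(* At most n - |D| free variables of a piece lie outside [D], so a piece above the bound has more
   than [uphalf #|D|] inside. *)
have bigR i : uphalf #|D| < #|[set j in D | R i j]|.
  have := big (s i); rewrite -ltnNge.
  have -> : [set j in D | R i j] = D :&: Z (s i) by apply/setP=> j; rewrite !inE.
  have -> : n - #|D| = #|~: D| by rewrite (cardsCs (~: D)) setCK card_ord.
  rewrite -(cardsID D (Z (s i))) setIC addnC => lt.
  rewrite -(ltn_add2l #|~: D|) addnC [X in _ < X]addnC; apply: leq_trans lt _.
  by rewrite leq_add2l subset_leq_card // setDE subsetIr.
(* Summing over [D] gives a contradiction, since 2(uphalf |D| + 1) >= |D| + 2 > |D| + 1. *)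
have := antisymmetric_count antiR.
rewrite leqNgt => /negP[]; apply: (@leq_trans (#|D| * (uphalf #|D|).+1).*2).
  rewrite -muln2 -mulnA ltn_pmul2l; last first.
    by rewrite card_gt0; apply/set0Pn; exists i0.
  by rewrite uphalf_half; have := odd_double_half #|D|; case: (odd _) => /=; lia.
by rewrite leq_double -sum_nat_const leq_sum.
Qed.
End PowerIdeal.

(** * The Stanley depth formula and its special cases *)

Lemma sdepth_power_ideal (K : fieldType) (n m : nat) (g : 'I_m -> 'I_n)
    (a : 'I_n -> nat) : (0 < m)%N -> injective g -> (forall i, (0 < a i)%N) ->
  sdepth (ideal_gen (fun i : 'I_m => ('X_(g i) : {mpoly K[n]}) ^+ a (g i)))
    = (n - m + uphalf m)%N.
Proof.
move=> m_gt0 g_inj a_gt0; pose D := g @: 'I_m.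
have cD : #|D| = m by rewrite card_imset // card_ord.
have mn : (m <= n)%N by rewrite -cD -[n in (_ <= n)%N]card_ord max_card.
have decP r (u : 'I_r -> 'X_{1..n}) (Z : 'I_r -> {set 'I_n}) :
    stanley_decomposition
      (ideal_gen (fun i : 'I_m => ('X_(g i) : {mpoly K[n]}) ^+ a (g i))) u Z
    <-> monomial_partition (fun i => in_piece (u i) (Z i)) (in_power_ideal D a).
  apply: direct_sumP => [i p|p]; [exact: stanley_spaceP | exact: ideal_genP].
apply: sdepth_eq.
- rewrite -[leqRHS](subnK mn) leq_add2l uphalf_half.
  by have := odd_double_half m; lia.
- have [r [u [Z [part cZ]]]] := power_ideal_partition a D.
  exists r, u, Z; split=> [|i]; first exact/decP.
  by rewrite -[X in (n - X)%N]cD -[X in uphalf X]cD.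
move=> r u Z /decP part; have [|i] := power_ideal_bound a_gt0 _ part.
  by rewrite -card_gt0 cD.
by rewrite cD; exists i.
Qed.

Theorem theorem1p3 (K : fieldType) (n : nat) (hn : (1 <= n)%N)
    (a : 'I_n -> nat) (ha : forall i, (0 < a i)%N) :
  (sdepth (ideal_gen (fun i : 'I_n => ('X_i : {mpoly K[n]}) ^+ a i))
     = sdepth (ideal_gen (fun i : 'I_n => ('X_i : {mpoly K[n]})))
   /\ sdepth (ideal_gen (fun i : 'I_n => ('X_i : {mpoly K[n]}))) = uphalf n)
  /\ (forall (m : nat) (hm : (1 <= m)%N) (hmn : (m <= n)%N),
        sdepth (ideal_gen (fun i : 'I_m =>
            ('X_(widen_ord hmn i) : {mpoly K[n]}) ^+ a (widen_ord hmn i)))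
          = (n - m + uphalf m)%N).
Proof.
have full b : (forall i, (0 < b i)%N) ->
    sdepth (ideal_gen (fun i : 'I_n => ('X_i : {mpoly K[n]}) ^+ b i)) = uphalf n.
  by move=> b_gt0; rewrite (@sdepth_power_ideal K n n id b) ?subnn.
have lin : sdepth (ideal_gen (fun i : 'I_n => ('X_i : {mpoly K[n]}))) = uphalf n.
  (* The first power of a variable is convertible to the variable. *)
  exact: (full (fun=> 1%N)).
split=> [|m hm hmn]; first by rewrite full.
by apply: sdepth_power_ideal => // i j /(congr1 val) /= /val_inj.
Qed.
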